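(* Let $G$ be a finite simple graph and $\Bbbk$ a field. Then $$\operatorname{reg}_{\Bbbk}(G)=\max\Big\{\sum_{i=1}^{r}\operatorname{reg}_{\Bbbk}(H_i)\;:\;\{H_1,\dots,H_r\}\text{ a prime decomposition of }G\text{ over }\Bbbk\Big\},$$ where the empty family ($r=0$, empty sum $0$) is allowed.
   Context: All graphs are finite and simple. For a graph $G$, $\operatorname{Ind}(G)$ is its independence complex (faces are the independent vertex sets), and $G[S]$ is the induced subgraph on $S\subseteq V(G)$. The regularity of $G$ over a field $\Bbbk$ is $\operatorname{reg}_{\Bbbk}(G)=\max\{j\ge 0:\widetilde H_{j-1}(\operatorname{Ind}(G[S]);\Bbbk)\neq 0\text{ for some }S\subseteq V(G)\}$, where $\operatorname{Ind}$ of the graph on the empty vertex set is $\{\emptyset\}$ with $\widetilde H_{-1}=\Bbbk$; equivalently $\operatorname{reg}_{\Bbbk}(G)=\operatorname{reg}(R/I(G))$ for the edge ideal $I(G)$. A connected graph $H$ is a prime graph over $\Bbbk$ if $\operatorname{reg}_{\Bbbk}(H-x)<\operatorname{reg}_{\Bbbk}(H)$ for every vertex $x$ of $H$. A prime decomposition of $G$ over $\Bbbk$ is a family $\{H_1,\dots,H_r\}$ of pairwise vertex-disjoint induced subgraphs of $G$, each a prime graph over $\Bbbk$, such that $G$ has no edge joining vertices of two different $H_i$ (i.e. $G[\bigcup_i V(H_i)]$ is the disjoint union of the $H_i$). *)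

(* Defs.v *)
From HB Require Import structures.
From mathcomp Require Import all_boot all_order all_algebra.
Set Implicit Arguments. Unset Strict Implicit. Unset Printing Implicit Defensive.
Import GRing.Theory.

(* A finite simple graph G is a type of vertices T : finType with a symmetric
   irreflexive edge relation e.  Induced subgraphs G[S] are given by vertex
   sets S : {set T}. *)

Section Graphs.
Variables (K : fieldType) (T : finType) (e : rel T).

Definition independent (F : {set T}) : bool :=
  [forall x in F, forall y in F, ~~ e x y].

(* faces of Ind(G[S]) with d vertices (i.e. of dimension d-1);
   the empty face has 0 vertices. *)
Definition face (S : {set T}) (d : nat) (F : {set T}) : bool :=
  [&& F \subset S, independent F & #|F| == d].

Definition nfaces (S : {set T}) (d : nat) : nat := #|[set F | face S d F]|.

Definition vlt (u v : T) : bool := (enum_rank u < enum_rank v)%N.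

(* The (augmented) simplicial boundary map of Ind(G[S]) over K, from chains on
   faces with d vertices to chains on faces with d-1 vertices, as a matrix
   (row-vector convention) indexed by all subsets of T; rows/columns of
   non-faces are zero.  For d = 0 it is the zero map. *)
Definition bd (S : {set T}) (d : nat) : 'M[K]_#|{set T}| :=
  \matrix_(i, j)
    (let F := enum_val (i : 'I_#|{set T}|) in
     let F' := enum_val (j : 'I_#|{set T}|) in
     if face S d F then
       \sum_(v in F) (if F' == F :\ v
                      then (-1) ^+ #|[set u in F | vlt u v]| else 0)
     else 0)%R.

(* dim_K  H~_{d-1}(Ind(G[S]); K)
     = dim ker bd_d - rank bd_{d+1}
     = (nfaces S d - rank bd_d) - rank bd_{d+1}. *)
Definition homology_dim (S : {set T}) (d : nat) : nat :=
  (nfaces S d - \rank (bd S d) - \rank (bd S d.+1))%N.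

Definition homology_nz (S : {set T}) (d : nat) : bool :=
  (0 < homology_dim S d)%N.

(* reg_K of the induced subgraph G[U]:
   max { j : H~_{j-1}(Ind(G[S]);K) <> 0 for some S \subset U }.
   (j ranges over j <= #|T|; for larger j there are no faces with j vertices,
   so the homology vanishes.) *)
Definition reg (U : {set T}) : nat :=
  \max_(S : {set T} | S \subset U) \max_(j < #|T|.+1 | homology_nz S j) j.

Definition connected_in (U : {set T}) : bool :=
  (U != set0) &&
  [forall x in U, forall y in U,
     connect [rel a b | [&& a \in U, b \in U & e a b]] x y].

Definition prime_graph (U : {set T}) : bool :=
  connected_in U && [forall x in U, (reg (U :\ x) < reg U)%N].

Definition prime_decomposition (P : {set {set T}}) : bool :=
  [&& [forall U in P, prime_graph U],
      trivIset P &
      [forall U in P, forall W in P, (U != W) ==>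
         [forall x in U, forall y in W, ~~ e x y]]].

End Graphs.

(* Main.v *)
(* Regularity is additive over disjoint unions without cross edges: the complex
   of such a union is a join, and the Kunneth formula over a field says that its
   homology is nonzero in degree [d] (counting vertices) iff the two factors have
   nonzero homology in degrees summing to [d].  Hence every prime decomposition
   gives a lower bound.  Conversely, delete vertices as long as the regularity
   does not drop, and split along connected components; what remains is a prime
   decomposition of the same total regularity. *)
Require Import Defs.
From HB Require Import structures.
From mathcomp Require Import all_boot all_order all_algebra.
Set Implicit Arguments. Unset Strict Implicit. Unset Printing Implicit Defensive.
Import GRing.Theory.

(** * Kunneth formula for matrix complexes *)

(** Only the nonvanishing of homology is compared, so no Kunneth isomorphism is built. All chains
    live in one space with a coordinate for each subset of [T]: the complexes of all induced
    subgraphs are cut out of the full simplex on [T], and degrees, supports and signs are diagonal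
    matrices. A pair of faces then indexes a matrix entry, so chains of a tensor product are
    matrices; the first differential acts on the left by its transpose, the second on the right. The
    obstacle is the vanishing direction. Exactness is known only degree by degree, and the exact
    factor may change with the degree, so there is no global contraction. The cycle is therefore
    first moved within its homology class until its homogeneous parts are cycles in both variables;
    each part can then be bounded through whichever factor is exact there. *)

Section GradedComplex.
Local Open Scope ring_scope.
Variables (K : fieldType) (N : nat).
Implicit Types (D E M : 'M[K]_N) (F : nat -> 'M[K]_N).

(* [D] is the differential, [F p] the projection onto degree [p], [E] the grading
   sign; chains are row vectors, and [F] vanishes off the chosen subcomplex. *)
Record graded_complex n D F E : Prop := GradedComplex {
  gc_idem : forall p q, F p *m F q = if p == q then F p else 0;
  gc_tr : forall p, (F p)^T = F p;
  gc_shift : forall p, F p.+1 *m D = D *m F p;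
  gc_bot : F 0 *m D = 0;
  gc_sum : D = \sum_(p < n) F p.+1 *m D;
  gc_sq : D *m D = 0;
  gc_signl : forall p, E *m F p = (-1) ^+ p *: F p;
  gc_signr : forall p, F p *m E = (-1) ^+ p *: F p;
  gc_signtr : E^T = E;
  gc_sign2 : E *m E = 1%:M }.

Lemma gc_anti n D F E : graded_complex n D F E -> D *m E = - (E *m D).
Proof.
move=> gc; rewrite (gc_sum gc) mulmx_suml mulmx_sumr -sumrN.
apply: eq_bigr => p _.
rewrite (gc_shift gc) -mulmxA (gc_signr gc) -scalemxAr -(gc_shift gc) mulmxA.
by rewrite (gc_signl gc) -scalemxAl exprS mulN1r scaleNr opprK.
Qed.

(* For a partial inverse [h] of [D], this chain map is homotopic to the identity. *)
Definition harm D h : 'M[K]_N := 1%:M - D *m h - h *m D.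

(** [pinvmx D] is a generalized inverse of [D] that need not respect the grading. Keeping only its
    blocks from degree [p] to degree [p.+1] gives a homogeneous [h], and [D *m h *m D = D] survives
    because [D] itself is homogeneous. *)
Lemma gc_homotopy n D F E : graded_complex n D F E ->
  exists h, [/\ D *m h *m D = D, E *m h = - (h *m E) &
                forall p, F p *m harm D h = harm D h *m F p].
Proof.
move=> gc; pose h := \sum_(p < n) F p *m pinvmx D *m F p.+1; exists h.
have DhD : D *m h *m D = D.
  rewrite [RHS](gc_sum gc) mulmx_sumr mulmx_suml; apply: eq_bigr => p _.
  have -> : D *m (F p *m pinvmx D *m F p.+1) *m D =
            (D *m F p) *m pinvmx D *m (F p.+1 *m D) by rewrite !mulmxA.
  rewrite -(gc_shift gc) {2}(gc_shift gc).
  have -> : F p.+1 *m D *m pinvmx D *m (D *m F p) =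
            F p.+1 *m (D *m pinvmx D *m D) *m F p by rewrite !mulmxA.
  by rewrite mulmxKpV // -mulmxA -(gc_shift gc) mulmxA (gc_idem gc) eqxx.
have hF p : F p *m h = h *m F p.+1.
  rewrite mulmx_sumr mulmx_suml; apply: eq_bigr => q _.
  have -> : F q *m pinvmx D *m F q.+1 *m F p.+1 =
            F q *m pinvmx D *m (F q.+1 *m F p.+1) by rewrite !mulmxA.
  rewrite (gc_idem gc) !mulmxA (gc_idem gc) eqSS eq_sym.
  by case: eqP => [->|_]; rewrite ?mulmx0 ?mul0mx // mulmxA.
have F0h : h *m F 0%N = 0.
  rewrite mulmx_suml big1 // => q _.
  by rewrite -mulmxA (gc_idem gc) mulmx0.
split=> //.
  rewrite mulmx_sumr mulmx_suml -sumrN; apply: eq_bigr => p _.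
  rewrite !mulmxA (gc_signl gc) -[in RHS]mulmxA (gc_signr gc) -scalemxAr.
  by rewrite -!scalemxAl exprS mulN1r scaleNr opprK.
case=> [|p]; rewrite /harm !(mulmxBr, mulmxBl) mulmx1 mul1mx !mulmxA.
  by rewrite (gc_bot gc) mul0mx hF -(mulmxA D) F0h mulmx0 -!mulmxA (gc_shift gc).
rewrite (gc_shift gc) -(mulmxA D) !hF !mulmxA; congr (_ - _).
by rewrite -!mulmxA (gc_shift gc).
Qed.

End GradedComplex.

(** * Vanishing of homology in a tensor product *)

Section Kunneth.
Local Open Scope ring_scope.
Variables (K : fieldType) (N n1 n2 : nat).
Variables (D1 D2 E : 'M[K]_N) (F1 F2 : nat -> 'M[K]_N).
Hypotheses (gc1 : graded_complex n1 D1 F1 E) (gc2 : graded_complex n2 D2 F2 E).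

(* The tensor product of two row complexes is a space of matrices; this is its
   total differential, with the Koszul sign carried by [E]. *)
Definition total_bd (M : 'M[K]_N) := D1^T *m M + E *m M *m D2.

Lemma total_bdD M1 M2 : total_bd (M1 + M2) = total_bd M1 + total_bd M2.
Proof. by rewrite /total_bd !(mulmxDr, mulmxDl) addrACA. Qed.

(** [Z] has many rows, so that all rows of a tensor chain are treated at once. *)
Definition exact_at (D F : 'M[K]_N) := forall Z : 'M[K]_N,
  Z *m F = Z -> Z *m D = 0 -> (Z <= D)%MS.

Lemma exact_homotopy (D F h Z : 'M[K]_N) : exact_at D F ->
  D *m h *m D = D -> Z *m F = Z -> Z *m D = 0 -> Z *m h *m D = Z.
Proof.
move=> ex DhD ZF ZD; have /submxP[Y ->] := ex _ ZF ZD.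
by rewrite -2!mulmxA (mulmxA D) DhD.
Qed.

(** The second and third hypotheses make [M] homogeneous of total degree [d]: its rows have degrees
    [p <= d], and the part in row degree [p] lives in column degree [d - p]. *)
Lemma kunneth_exact d (M : 'M[K]_N) :
  total_bd M = 0 -> M = \sum_(p < d.+1) F1 p *m M ->
  (forall p, (p <= d)%N -> F1 p *m M *m F2 (d - p) = F1 p *m M) ->
  (forall p, (p <= d)%N -> exact_at D1 (F1 p) \/ exact_at D2 (F2 (d - p))) ->
  exists Y, M = total_bd Y.
Proof.
move=> dM0 sumM dM exM.
have [h [DhD Eh harmF]] := gc_homotopy gc1.
have [k [DkD _ harmF2]] := gc_homotopy gc2.
(* The first complex acts on row indices, so its operators are transposed and multiply from the
   left. *)
pose X := D1^T; pose g := h^T; pose pi1 := (harm D1 h)^T; pose pi2 := harm D2 k.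
have XgX : X *m g *m X = X by rewrite -!trmx_mul mulmxA DhD.
have XX : X *m X = 0 by rewrite -trmx_mul (gc_sq gc1) trmx0.
have EX : X *m E = - (E *m X).
  apply: trmx_inj; rewrite linearN /= !trmx_mul trmxK (gc_signtr gc1).
  by rewrite (gc_anti gc1) opprK.
have Eg : E *m g = - (g *m E).
  apply: trmx_inj; rewrite linearN /= !trmx_mul trmxK (gc_signtr gc1).
  by rewrite Eh opprK.
have total_bd_sq Y : total_bd (total_bd Y) = 0.
  rewrite /total_bd -/X !(mulmxDr, mulmxDl) !mulmxA XX mul0mx add0r EX.
  rewrite -(mulmxA _ D2) (gc_sq gc2) mulmx0 addr0.
  by rewrite !mulNmx addNr.
have pi1E : pi1 = 1%:M - g *m X - X *m g.
  by rewrite /pi1 /harm !linearB /= !trmx_mul trmx1.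
have pi1F p : F1 p *m pi1 = pi1 *m F1 p.
  by apply: trmx_inj; rewrite !trmx_mul (gc_tr gc1) trmxK harmF.
have Xpi1 : X *m pi1 = 0.
  rewrite pi1E !mulmxBr mulmx1 !mulmxA XX mul0mx XgX subr0 subrr //.
have pi2D : pi2 *m D2 = 0.
  rewrite /pi2 /harm !mulmxBl mul1mx DkD -(mulmxA k) (gc_sq gc2) mulmx0.
  by rewrite subr0 subrr.
have dM1 : X *m M = - (E *m M *m D2) by apply/eqP; rewrite -addr_eq0; apply/eqP.
(* [M] is homologous to [R = pi1 M], then to [Q = pi1 M pi2], whose homogeneous
   parts are cycles in both variables and so bound wherever a factor is exact. *)
have [R RE] : exists R, R = pi1 *m M by exists (pi1 *m M).
have [Q QE] : exists Q, Q = R *m pi2 by exists (R *m pi2).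
have XR : X *m R = 0 by rewrite RE mulmxA Xpi1 mul0mx.
(* [M - pi1 *m M] is [g *m X *m M + X *m g *m M]; the cycle condition turns the first term into the
   Koszul term of [total_bd (g *m M)]. *)
have MR : M = R + total_bd (g *m M).
  rewrite RE pi1E !mulmxBl mul1mx /total_bd -/X !mulmxA Eg.
  rewrite -(mulmxA g) dM1 mulmxN !mulNmx opprK !mulmxA.
  by rewrite addrA subrK addrK.
have RD2 : R *m D2 = 0.
  have : total_bd M = total_bd R + total_bd (total_bd (g *m M)) by rewrite -total_bdD -MR.
  rewrite dM0 total_bd_sq addr0 /total_bd -/X XR add0r => /esym/(congr1 (mulmx E)).
  by rewrite !mulmxA (gc_sign2 gc1) mul1mx mulmx0.
have XQ : X *m Q = 0 by rewrite QE mulmxA XR mul0mx.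
have QD : Q *m D2 = 0 by rewrite QE -mulmxA pi2D mulmx0.
(* The factor [E] in the primitive cancels the Koszul sign, leaving [R *m k *m D2], which is [R - Q]
   because [R *m D2 = 0]. *)
have RQ : R = Q + total_bd (E *m R *m k).
  rewrite /total_bd -/X !mulmxA (gc_sign2 gc1) mul1mx EX.
  rewrite !mulNmx -(mulmxA E X) XR mulmx0 mul0mx oppr0 add0r.
  rewrite QE /pi2 /harm !mulmxBr mulmx1 !mulmxA RD2 mul0mx subr0.
  by rewrite subrK.
have FQ p : (p <= d)%N -> F1 p *m Q *m F2 (d - p) = F1 p *m Q.
  move=> le_pd; rewrite QE RE !mulmxA pi1F -(mulmxA _ pi2) -harmF2 !mulmxA.
  by rewrite -(mulmxA pi1) -(mulmxA pi1) dM.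
have sumQ : Q = \sum_(p < d.+1) F1 p *m Q.
  rewrite QE RE {1}sumM mulmx_sumr mulmx_suml; apply: eq_bigr => p _.
  by rewrite !mulmxA pi1F.
suff [Y QY] : exists Y, Q = total_bd Y.
  exists (Y + E *m R *m k + g *m M).
  by rewrite {1}MR {1}RQ {1}QY !total_bdD.
rewrite sumQ; elim/big_rec: _ => [|p S _ [Y ->]].
  by exists 0; rewrite /total_bd !(mulmx0, mul0mx) addr0.
suff [Z ->] : exists Z, F1 p *m Q = total_bd Z by exists (Z + Y); rewrite total_bdD.
have le_pd : (p <= d)%N by rewrite -ltnS.
have QpD : F1 p *m Q *m D2 = 0 by rewrite -mulmxA QD mulmx0.
(* [X] shifts the row degree, so it can be moved past [F1 p] at the cost of changing the projection,
   until it meets [Q]; in degree 0 the product [X *m F1 0] already vanishes. *)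
have XQp : X *m (F1 p *m Q) = 0.
  suff [G XF] : exists G, X *m F1 p = G *m X by rewrite mulmxA XF -mulmxA XQ mulmx0.
  case: {+}(p : nat) => [|q]; [exists 0 | exists (F1 q)].
    by apply: trmx_inj; rewrite mul0mx trmx0 trmx_mul trmxK (gc_tr gc1) (gc_bot gc1).
  by apply: trmx_inj; rewrite !trmx_mul !trmxK !(gc_tr gc1) (gc_shift gc1).
(* The homotopy of the exact factor provides the primitive: [g] on the left, or [k] on the right
   together with a sign [E]. *)
have [ex|ex] := exM p le_pd.
  exists (g *m (F1 p *m Q)); rewrite /total_bd -/X.
  have -> : E *m (g *m (F1 p *m Q)) *m D2 = E *m g *m (F1 p *m Q *m D2).
    by rewrite !mulmxA.
  rewrite QpD mulmx0 addr0.
  apply: trmx_inj; rewrite !(trmx_mul g, trmx_mul X) !trmxK.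
  rewrite (exact_homotopy ex) //.
    by rewrite trmx_mul (gc_tr gc1) -mulmxA (gc_idem gc1) eqxx.
  by apply: trmx_inj; rewrite trmx_mul trmxK trmx0.
exists (E *m (F1 p *m Q) *m k); rewrite /total_bd -/X.
have XE0 : X *m E *m (F1 p *m Q) = 0.
  by rewrite EX mulNmx -(mulmxA E) XQp mulmx0 oppr0.
rewrite 2!mulmxA XE0 mul0mx add0r 2!(mulmxA E) (gc_sign2 gc1) mul1mx.
by rewrite (exact_homotopy ex) //; apply: FQ.
Qed.

End Kunneth.

(** * Independence complexes *)

Section Boundary.
Local Open Scope ring_scope.
Variables (K : fieldType) (T : finType).
Implicit Types (F G S : {set T}) (u v w : T).
Local Notation N := #|{set T}|.
Local Notation rk F := (enum_rank (F : {set T})).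

Lemma vlt_neq u v : u != v -> vlt v u = ~~ vlt u v.
Proof.
move=> neq_uv; rewrite /vlt -leqNgt [RHS]leq_eqVlt orbC.
by rewrite val_eqE (inj_eq enum_rank_inj) eq_sym (negbTE neq_uv) orbF.
Qed.

(** Signs are products of pairwise comparisons rather than powers of -1, so that they factor over
    vertex insertions and disjoint unions. *)
Definition sgn u v : K := if vlt u v then -1 else 1.
Definition chi F v : K := \prod_(u in F) sgn u v.

Lemma sgn_sq u v : sgn u v * sgn u v = 1.
Proof. by rewrite /sgn; case: ifP; rewrite ?mulrNN mulr1. Qed.

Lemma sgn_anti u v : u != v -> sgn u v = - sgn v u.
Proof. by move=> /vlt_neq; rewrite /sgn => ->; case: vlt; rewrite ?opprK. Qed.

Lemma chiE F v : (-1) ^+ #|[set u in F | vlt u v]| = chi F v.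
Proof.
rewrite /chi /sgn -big_mkcondr /= prodr_const; congr (_ ^+ _).
by apply: eq_card => u; rewrite !inE.
Qed.

Lemma chi_setU1 F v w : v \notin F -> chi (v |: F) w = sgn v w * chi F w.
Proof. by move=> vF; rewrite /chi big_setU1. Qed.

Lemma chi_self F v : v \notin F -> chi (v |: F) v = chi F v.
Proof. by move=> vF; rewrite chi_setU1 // /sgn /vlt ltnn mul1r. Qed.

Lemma mx_setP m (A B : 'M[K]_(m, N)) :
  (forall i F, A i (rk F) = B i (rk F)) -> A = B.
Proof. by move=> AB; apply/matrixP => i j; rewrite -(enum_valK j) AB. Qed.

Lemma mx_setP2 (A B : 'M[K]_N) :
  (forall F G, A (rk F) (rk G) = B (rk F) (rk G)) -> A = B.
Proof. by move=> AB; apply: mx_setP => i F; rewrite -(enum_valK i) AB. Qed.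

(** The augmented boundary of the full simplex on [T]. Restricting its rows to faces gives the
    boundary of every [Ind(G[S])], so the boundary squares to zero by a single computation. *)
Definition bd0 : 'M[K]_N := \matrix_(i, j)
  (let F := enum_val (i : 'I_N) in let F' := enum_val (j : 'I_N) in
   \sum_(v in F)
     (if F' == F :\ v then (-1) ^+ #|[set u in F | vlt u v]| else 0)).

(** With row vectors, the coefficient of a boundary at [F] collects the cofaces of [F]; later sign
    computations thus insert vertices instead of deleting them. *)
Lemma mulmx_bd0 m (M : 'M[K]_(m, N)) i F :
  (M *m bd0) i (rk F) = \sum_(v | v \notin F) chi F v * M i (rk (v |: F)).
Proof.
rewrite mxE (reindex (@enum_rank _)); last exact: onW_bij (enum_rank_bij _).
under eq_bigr => G _ do rewrite mxE !enum_rankK mulr_sumr.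
rewrite (exchange_big_dep xpredT) //= [RHS]big_mkcond /=.
apply: eq_bigr => v _; case: ifP => [vF | /negbFE vF].
  rewrite (bigD1 (v |: F)) /= ?setU11 // setU1K // eqxx chiE chi_self //.
  rewrite mulrC big1 ?addr0 // => G /andP[vG neqG].
  case: eqP => [FG|]; last by rewrite mulr0.
  by rewrite FG setD1K ?eqxx in neqG.
rewrite big1 // => G vG; case: eqP => [FG|]; last by rewrite mulr0.
by rewrite FG !inE eqxx in vF.
Qed.

(** Inserting [v] and [w] in either order reaches the same coface, and the two coefficients differ
    by [sgn v w = - sgn w v]. The sum over pairs thus splits by [vlt v w] into two opposite
    halves. *)
Lemma bd0_sq : bd0 *m bd0 = 0.
Proof.
(* The identity matrix in front lets the coface formula apply to both factors. *)
rewrite -[bd0 in X in X *m _]mul1mx; apply: mx_setP => i F.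
rewrite mulmx_bd0 [RHS]mxE; set A := (1%:M : 'M_N).
pose t v w := chi F v * (chi F w * sgn v w * A i (rk (w |: (v |: F)))).
pose P v w := [&& v \notin F, w \notin F & v != w].
have -> : \sum_(v | v \notin F) chi F v * (A *m bd0) i (rk (v |: F)) =
          \sum_v \sum_(w | P v w) t v w.
  rewrite big_mkcond; apply: eq_bigr => v _; rewrite /P; case: ifP => vF; last first.
    by rewrite big_pred0.
  rewrite mulmx_bd0 mulr_sumr; apply: eq_big => [w | w wF].
    by rewrite !inE negb_or eq_sym andbC.
  by rewrite chi_setU1 // (mulrC (sgn _ _)).
pose s := \sum_v \sum_(w | P v w && vlt v w) t v w.
have -> : \sum_v \sum_(w | P v w) t v w = s + (- s).
  rewrite -[RHS]addrC -[in - s]/s.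
  have -> : - s = \sum_v \sum_(w | P v w && ~~ vlt v w) t v w.
    rewrite /s (exchange_big_dep xpredT) //= -sumrN; apply: eq_bigr => v _.
    rewrite -sumrN; apply: eq_big => [w | w /andP[/and3P[wF vF neq] _]].
      rewrite /P; case: (altP (w =P v)) => [->|neq]; first by rewrite ?eqxx !andbF.
      by rewrite (vlt_neq neq) negbK (eq_sym v) neq /= !andbT [X in X && _]andbC.
    rewrite /t (sgn_anti neq) setUCA mulrN mulNr mulrN opprK.
    by rewrite -!mulrA mulrCA.
  rewrite -big_split /=; apply: eq_bigr => v _.
  by rewrite (bigID (vlt v)) addrC.
by rewrite subrr.
Qed.

Definition dg (f : {set T} -> K) : 'M[K]_N := diag_mx (\row_i f (enum_val i)).

Lemma dg_mulE m (f : {set T} -> K) (A : 'M[K]_(N, m)) F j :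
  (dg f *m A) (rk F) j = f F * A (rk F) j.
Proof. by rewrite mul_diag_mx !mxE enum_rankK. Qed.

Lemma mul_dgE m (f : {set T} -> K) (A : 'M[K]_(m, N)) i F :
  (A *m dg f) i (rk F) = A i (rk F) * f F.
Proof. by rewrite mul_mx_diag !mxE enum_rankK. Qed.

Lemma dg_tr f : (dg f)^T = dg f.
Proof. exact: tr_diag_mx. Qed.

Lemma eq_dg f g : f =1 g -> dg f = dg g.
Proof. by move=> fg; congr diag_mx; apply/rowP => i; rewrite !mxE fg. Qed.

Lemma dg_mul f g : dg f *m dg g = dg (fun F => f F * g F).
Proof.
by rewrite /dg mulmx_diag; congr diag_mx; apply/rowP=> i; rewrite !mxE.
Qed.

Lemma dg1 : dg (fun=> 1) = 1%:M.
Proof. by rewrite -diag_const_mx; congr diag_mx; apply/rowP=> i; rewrite !mxE. Qed.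

Lemma dg0 : dg (fun=> 0) = 0.
Proof. by apply: mx_setP2 => F G; rewrite !mxE mul0rn. Qed.

Lemma dg_scale c f : c *: dg f = dg (fun F => c * f F).
Proof. by rewrite /dg -linearZ; congr diag_mx; apply/rowP=> i; rewrite !mxE. Qed.

Lemma dg_sum (I : finType) (P : pred I) f :
  \sum_(i | P i) dg (f i) = dg (fun F => \sum_(i | P i) f i F).
Proof.
rewrite /dg -linear_sum; congr diag_mx; apply/rowP=> i; rewrite !mxE summxE.
by apply: eq_bigr => j _; rewrite mxE.
Qed.

(* All relations between [bd0] and the face projections reduce to a check on
   each incident pair [F :\ v] of [F]. *)
Lemma dg_bd0_dg f g f' g' :
  (forall F v, v \in F -> f F * g (F :\ v) = f' F * g' (F :\ v)) ->
  dg f *m bd0 *m dg g = dg f' *m bd0 *m dg g'.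
Proof.
move=> fg; apply: mx_setP2 => F G; rewrite !mul_dgE !dg_mulE mxE !enum_rankK.
rewrite !mulr_sumr !mulr_suml; apply: eq_bigr => v vF.
case: eqP => [->|_]; last by rewrite !(mulr0, mul0r).
by rewrite mulrAC fg // mulrAC.
Qed.

End Boundary.

(** * The graded complex of an independence complex and its homology *)

Section IndComplex.
Local Open Scope ring_scope.
Variables (K : fieldType) (T : finType) (e : rel T).
Implicit Types (F G S : {set T}) (u v w : T).
Local Notation N := #|{set T}|.
Local Notation rk F := (enum_rank (F : {set T})).
Local Notation bd0 := (bd0 K T).
Local Notation dg := (@dg K T).

Lemma independentP F :
  reflect {in F &, forall x y, ~~ e x y} (independent e F).
Proof.
apply: (iffP forall_inP) => [H x y xF yF | H x xF].
  by move/forall_inP: (H x xF); apply.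
by apply/forall_inP => y yF; apply: H.
Qed.

Lemma independent_sub F G : F \subset G -> independent e G -> independent e F.
Proof.
move=> /subsetP FG /independentP iG; apply/independentP => x y xF yF.
by apply: iG; apply: FG.
Qed.

Definition simplex S F := (F \subset S) && independent e F.
Definition simplices S := dg (fun F => (simplex S F)%:R).
Definition simplices_at S d := dg (fun F => (face e S d F)%:R).
Definition ind_bd S := simplices S *m bd0.
Definition sign_mx : 'M[K]_N := dg (fun F => (-1) ^+ #|F|).

Lemma faceE S d F : face e S d F = simplex S F && (#|F| == d).
Proof. by rewrite /face /simplex andbA. Qed.

Lemma simplex_setD1 S F v : simplex S F -> simplex S (F :\ v).
Proof.
case/andP=> FS iF; apply/andP; split; first exact: subset_trans (subsetDl _ _) FS.
exact: independent_sub (subsetDl _ _) iF.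
Qed.

Lemma bdE S d : bd K e S d = simplices_at S d *m bd0.
Proof.
apply: mx_setP2 => F G; rewrite dg_mulE !mxE !enum_rankK.
by case sF: face; rewrite ?mul1r ?mul0r /= sF.
Qed.

(** The projection factors as [B^T *m B] through [#|A|] coordinates, with [B *m B^T = 1%:M]; this
    squeezes its rank from both sides. *)
Lemma mxrank_dg_mem (A : {set {set T}}) : \rank (dg (fun F => (F \in A)%:R)) = #|A|.
Proof.
pose B : 'M[K]_(#|A|, N) := \matrix_(i, j) (enum_val i == enum_val j)%:R.
have BB : B *m B^T = 1%:M.
  apply/matrixP => i j; rewrite !mxE.
  rewrite (bigD1 (rk (enum_val i))) //= !mxE !enum_rankK eqxx mul1r.
  rewrite big1 ?addr0 => [|k neq]; first by rewrite (inj_eq enum_val_inj) eq_sym.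
  rewrite !mxE; case: eqP => [ik|]; last by rewrite mul0r.
  by rewrite ik enum_valK eqxx in neq.
have BA : B^T *m B = dg (fun F => (F \in A)%:R).
  apply: mx_setP2 => F G; rewrite !mxE (inj_eq enum_rank_inj) !enum_rankK.
  case: (boolP (F \in A)) => FA; last first.
    rewrite mul0rn big1 // => i _; rewrite !mxE !enum_rankK.
    case: eqP => [iF|]; last by rewrite mul0r.
    by rewrite -iF enum_valP in FA.
  rewrite (bigD1 (enum_rank_in FA F)) //= !mxE !enum_rankK enum_rankK_in // eqxx.
  rewrite mul1r big1 ?addr0 // => i neq; rewrite !mxE enum_rankK.
  case: eqP => [iF|]; last by rewrite mul0r.
  by case/eqP: neq; apply: enum_val_inj; rewrite enum_rankK_in.
apply/eqP; rewrite eqn_leq -BA; apply/andP; split.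
  by rewrite (leq_trans (mxrankM_maxr _ _)) // rank_leq_row.
have rkB : \rank (B *m (B^T *m B) *m B^T) = #|A|.
  by rewrite !mulmxA BB mul1mx BB mxrank1.
by rewrite -[X in (X <= _)%N]rkB (leq_trans (mxrankM_maxl _ _)) // mxrankM_maxr.
Qed.

Lemma nfacesE S d : nfaces e S d = \rank (simplices_at S d).
Proof.
rewrite /nfaces -mxrank_dg_mem; congr (\rank _); apply: eq_dg => F.
by rewrite inE.
Qed.

Lemma ind_bd_simplices S : ind_bd S *m simplices S = ind_bd S.
Proof.
rewrite /ind_bd -[RHS]mulmx1 -dg1; apply: dg_bd0_dg => F v vF.
by case: (boolP (simplex S F)) => [/simplex_setD1-> | _]; rewrite ?mul0r.
Qed.

Lemma simplices_idem S : simplices S *m simplices S = simplices S.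
Proof. by rewrite dg_mul; apply: eq_dg => F; rewrite -natrM mulnb andbb. Qed.

Lemma simplices_tr S : (simplices S)^T = simplices S.
Proof. exact: dg_tr. Qed.

Lemma simplices_ind_bd S : simplices S *m ind_bd S = ind_bd S.
Proof. by rewrite /ind_bd mulmxA simplices_idem. Qed.

Lemma simplices_at_simplices S d :
  simplices_at S d *m simplices S = simplices_at S d.
Proof.
rewrite dg_mul; apply: eq_dg => F; rewrite -natrM mulnb faceE.
by rewrite andbAC andbb.
Qed.

Lemma ind_bd_shift S d :
  simplices_at S d.+1 *m ind_bd S = ind_bd S *m simplices_at S d.
Proof.
rewrite /ind_bd mulmxA simplices_at_simplices.
rewrite -[LHS]mulmx1 -dg1; apply: dg_bd0_dg => F v vF.
rewrite !faceE mulr1 -natrM mulnb; congr (nat_of_bool _)%:R.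
case: (boolP (simplex S F)) => [/simplex_setD1-> | _] //=.
by rewrite (cardsD1 v F) vF.
Qed.

Lemma ind_complex S :
  graded_complex #|T| (ind_bd S) (simplices_at S) sign_mx.
Proof.
split.
- move=> p q; rewrite dg_mul; case: eqP => [<-|neq].
    by apply: eq_dg => F; rewrite -natrM mulnb andbb.
  rewrite -dg0; apply: eq_dg => F; rewrite -natrM mulnb !faceE.
  by rewrite andbACA; case: eqP => [->|]; case: eqP => //; rewrite ?andbF.
- by move=> p; rewrite dg_tr.
- exact: ind_bd_shift.
- rewrite /ind_bd mulmxA simplices_at_simplices -[LHS]mulmx1 -dg1.
  have <- : dg (fun=> 0) *m bd0 *m dg (fun=> 0) = 0 by rewrite dg0 !mul0mx.
  apply: dg_bd0_dg => F v vF.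
  by rewrite mulr0 faceE cards_eq0; case: eqP vF => [->|]; rewrite ?inE // andbF mul0r.
(* A nonempty face [F] is caught exactly by the index [#|F|.-1], which is below [#|T|]; the empty
   face has zero boundary. *)
- rewrite -mulmx_suml dg_sum /ind_bd mulmxA dg_mul -[LHS]mulmx1 -[RHS]mulmx1 -dg1.
  apply: dg_bd0_dg => F v vF; congr (_ * _).
  case: (boolP (simplex S F)) => sF; last by rewrite mulr0.
  have cF : (#|F|.-1 < #|T|)%N.
    by rewrite (leq_trans _ (max_card F)) // prednK // (cardsD1 v) vF.
  rewrite (bigD1 (Ordinal cF)) //= faceE sF prednK ?eqxx; last first.
    by rewrite (cardsD1 v) vF.
  rewrite big1 ?addr0 ?mulr1 // => p neq; rewrite faceE sF /=.
  case: eqP => // cFp; case/eqP: neq; apply: val_inj => /=; by rewrite cFp.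
- by rewrite {2}/ind_bd mulmxA ind_bd_simplices -mulmxA bd0_sq mulmx0.
- move=> p; rewrite dg_mul dg_scale; apply: eq_dg => F; rewrite faceE.
  by case: eqP => [->|]; rewrite ?andbF ?mulr0.
- move=> p; rewrite dg_mul dg_scale; apply: eq_dg => F; rewrite faceE.
  by rewrite mulrC; case: eqP => [->|]; rewrite ?andbF ?mulr0.
- by rewrite dg_tr.
- by rewrite dg_mul -dg1; apply: eq_dg => F; rewrite -expr2 sqrr_sign.
Qed.

(** Replaces the rank formula by a cycle that is not a boundary. The ranks compare the cycle space
    [Z] with its subspace of boundaries, so the difference is positive iff the inclusion is strict.
    Testing against [ind_bd S] in all degrees is harmless since the boundary is homogeneous. *)
Lemma homology_nzP S d :
  reflect (exists2 z : 'rV[K]_N, z *m simplices_at S d = z &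
             z *m bd0 = 0 /\ ~~ (z <= ind_bd S)%MS)
          (homology_nz K e S d).
Proof.
set Z := (simplices_at S d :&: kermx bd0)%MS.
have gc := ind_complex S.
have bd_ind p : bd K e S p = simplices_at S p *m ind_bd S.
  by rewrite bdE /ind_bd mulmxA simplices_at_simplices.
have subZ : (bd K e S d.+1 <= Z)%MS.
  rewrite sub_capmx {1}bd_ind (gc_shift gc) submxMl sub_kermx bdE.
  by rewrite -mulmxA bd0_sq mulmx0 eqxx.
have rkZ : (nfaces e S d - \rank (bd K e S d))%N = \rank Z.
  by rewrite nfacesE bdE -(mxrank_mul_ker (simplices_at S d) bd0) addKn.
have -> : homology_nz K e S d = ~~ (Z <= bd K e S d.+1)%MS.
  rewrite /homology_nz /homology_dim rkZ subn_gt0 ltnNge.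
  by rewrite (geq_leqif (mxrank_leqif_sup subZ)).
have atK : simplices_at S d *m simplices_at S d = simplices_at S d.
  by rewrite (gc_idem gc) eqxx.
apply: (iffP row_subPn) => [[i] | [z zF [zbd]]].
  have : (row i Z <= Z)%MS by apply: row_sub.
  rewrite {2}/Z sub_capmx => /andP[/submxP[y yE] /sub_kermxP iker] nb.
  have iF : row i Z *m simplices_at S d = row i Z by rewrite yE -mulmxA atK.
  (* Projecting to [d] vertices turns any primitive of the row into one supported on faces with
     [d.+1] vertices. *)
  exists (row i Z) => //; split=> //; apply: contra nb => /submxP[x xE].
  apply/submxP; exists x; rewrite -iF xE bd_ind (gc_shift gc) mulmxA //.
have zZ : (z <= Z)%MS by rewrite sub_capmx -{1}zF submxMl sub_kermx zbd eqxx.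
move=> nb; apply/row_subPn; apply: contra nb => Zb.
apply: submx_trans zZ (submx_trans Zb _).
by rewrite bd_ind submxMl.
Qed.
End IndComplex.

(** * Joins *)

Section Join.
Local Open Scope ring_scope.
Variables (K : fieldType) (T : finType) (e : rel T) (S1 S2 : {set T}).
Hypotheses (e_sym : symmetric e) (dis : [disjoint S1 & S2])
  (noedge : {in S1 & S2, forall x y, ~~ e x y}).
Implicit Types (A B F G : {set T}) (u v w : T).
Local Notation N := #|{set T}|.
Local Notation rk F := (enum_rank (F : {set T})).
Local Notation bd0 := (bd0 K T).
Local Notation dg := (@dg K T).
Local Notation S := (S1 :|: S2).
Local Notation simplices := (simplices K e).
Local Notation simplices_at := (simplices_at K e).
Local Notation bdI := (ind_bd K e).
Local Notation sign_mx := (sign_mx K T).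
Local Notation joind := (total_bd (bdI S1) (bdI S2) sign_mx).

Lemma notin_S2 v : v \in S1 -> v \notin S2.
Proof. by move=> vS; rewrite (disjointFr dis vS). Qed.

Lemma simplex_joinE A B : A \subset S1 -> B \subset S2 ->
  simplex e S (A :|: B) = simplex e S1 A && simplex e S2 B.
Proof.
move=> sA sB; rewrite /simplex sA sB setUSS //=.
apply/idP/andP => [iAB | [/independentP iA /independentP iB]].
  by split; apply: independent_sub iAB; rewrite ?subsetUl ?subsetUr.
have [sA' sB'] := (subsetP sA, subsetP sB).
apply/independentP => x y; rewrite !inE => /orP[] xAB /orP[] yAB.
- exact: iA.
- by apply: noedge; [apply: sA' | apply: sB'].
- by rewrite e_sym; apply: noedge; [apply: sA' | apply: sB'].
- exact: iB.
Qed.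

(* Sign of the shuffle sorting [A] followed by [B]. *)
Definition cross A B : K := \prod_(a in A) \prod_(b in B) sgn K b a.

Lemma cross_sq A B : cross A B * cross A B = 1.
Proof.
rewrite -big_split /= big1 // => a _; rewrite -big_split /= big1 // => b _.
exact: sgn_sq.
Qed.

Lemma cross_setU1l A B v : v \notin A -> cross (v |: A) B = chi K B v * cross A B.
Proof. by move=> vA; rewrite /cross big_setU1. Qed.

(** Reversing the comparisons of [v] with all of [A] costs [(-1) ^+ #|A|]. This is the Koszul sign
    that [sign_mx] carries in the total differential. *)
Lemma cross_setU1r A B v : v \notin A -> v \notin B ->
  cross A (v |: B) = (-1) ^+ #|A| * chi K A v * cross A B.
Proof.
move=> vA vB; rewrite /cross /chi -prodr_const -!big_split /=.
apply: eq_bigr => a aA; rewrite big_setU1 //= mulN1r -sgn_anti //.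
by apply: contraNneq vA => ->.
Qed.

Lemma chi_join A B v : [disjoint A & B] -> chi K (A :|: B) v = chi K A v * chi K B v.
Proof. by move=> disAB; rewrite /chi -bigU //=; apply: eq_bigl => x; rewrite !inE. Qed.

(* The coordinate of a chain on [A :|: B], up to shuffle sign, is the [(A, B)]
   entry of a matrix; this identifies the chains of a join with a tensor product. *)
Definition join_split (z : 'rV[K]_N) : 'M[K]_N := \matrix_(i, j)
  (let A := enum_val (i : 'I_N) in let B := enum_val (j : 'I_N) in
   if simplex e S1 A && simplex e S2 B then cross A B * z 0 (rk (A :|: B)) else 0).

Definition join_merge (M : 'M[K]_N) : 'rV[K]_N := \row_j
  (let F := enum_val (j : 'I_N) in
   if simplex e S F
   then cross (F :&: S1) (F :&: S2) * M (rk (F :&: S1)) (rk (F :&: S2)) else 0).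

Lemma join_splitE z A B : join_split z (rk A) (rk B) =
  if simplex e S1 A && simplex e S2 B then cross A B * z 0 (rk (A :|: B)) else 0.
Proof. by rewrite mxE /= !enum_rankK. Qed.

Lemma join_mergeE M F : join_merge M 0 (rk F) = if simplex e S F
   then cross (F :&: S1) (F :&: S2) * M (rk (F :&: S1)) (rk (F :&: S2)) else 0.
Proof. by rewrite mxE /= !enum_rankK. Qed.

Lemma join_split0 : join_split 0 = 0.
Proof. by apply: mx_setP2 => A B; rewrite join_splitE !mxE mulr0 if_same. Qed.

Lemma supp_simplices (z : 'rV[K]_N) F : z *m simplices S = z -> ~~ simplex e S F ->
  z 0 (rk F) = 0.
Proof. by move=> <- /negbTE sF; rewrite mul_dgE sF mulr0. Qed.

Lemma join_merge_simplices M : join_merge M *m simplices S = join_merge M.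
Proof.
apply: mx_setP => i F; rewrite ord1 mul_dgE join_mergeE.
by case: ifP; rewrite ?mulr1 ?mul0r.
Qed.

Lemma join_capl A B : A \subset S1 -> B \subset S2 -> (A :|: B) :&: S1 = A.
Proof.
move=> sA sB; rewrite setIUl (setIidPl sA).
suff -> : B :&: S1 = set0 by rewrite setU0.
by apply/eqP; rewrite setI_eq0 disjoint_sym; apply: disjointWr sB dis.
Qed.

Lemma join_capr A B : A \subset S1 -> B \subset S2 -> (A :|: B) :&: S2 = B.
Proof.
move=> sA sB; rewrite setIUl (setIidPl sB).
suff -> : A :&: S2 = set0 by rewrite set0U.
by apply/eqP; rewrite setI_eq0; apply: disjointWl sA dis.
Qed.

Lemma join_splitK z : z *m simplices S = z -> join_merge (join_split z) = z.
Proof.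
move=> zS; apply: mx_setP => i F; rewrite ord1 join_mergeE.
case: ifPn => [sF | /(supp_simplices zS)-> //]; rewrite join_splitE.
have FE : F = (F :&: S1) :|: (F :&: S2).
  by rewrite -setIUr; apply/esym/setIidPl; case/andP: sF.
by rewrite -simplex_joinE ?subsetIr // -FE sF mulrA cross_sq mul1r.
Qed.

Lemma join_mergeK M : simplices S1 *m M *m simplices S2 = M -> join_split (join_merge M) = M.
Proof.
move=> MS; apply: mx_setP2 => A B; rewrite join_splitE -[in RHS]MS mul_dgE dg_mulE.
case: (boolP (simplex e S1 A)) => sA /=; last by rewrite !mul0r.
case: (boolP (simplex e S2 B)) => sB /=; last by rewrite mulr0.
have [[AS _] [BS _]] := (andP sA, andP sB).
rewrite join_mergeE simplex_joinE // sA sB join_capl // join_capr //.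
by rewrite mulrA cross_sq !mul1r mulr1.
Qed.

(** A coface of [A :|: B] adds its vertex either to [A], giving the term of the first differential,
    or to [B], giving the signed term of the second. Cofaces that are not faces contribute nothing,
    as [z] is supported on faces. *)
Lemma join_split_bd z : z *m simplices S = z -> join_split (z *m bd0) = joind (join_split z).
Proof.
move=> zS; have zE F : ~~ simplex e S F -> z 0 (rk F) = 0 by apply: supp_simplices.
have spl : simplices S1 *m join_split z = join_split z.
  apply: mx_setP2 => A B; rewrite dg_mulE join_splitE.
  by case: simplex; rewrite ?mul1r ?mulr0 ?mul0r.
have spr : join_split z *m simplices S2 = join_split z.
  apply: mx_setP2 => A B; rewrite mul_dgE join_splitE andbC.
  by case: simplex; rewrite ?mulr1 ?mulr0 ?mul0r.
have -> : joind (join_split z) =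
    ((join_split z)^T *m bd0)^T + sign_mx *m (join_split z *m bd0).
  rewrite /total_bd /ind_bd; congr (_ + _); last first.
    by rewrite -mulmxA (mulmxA (join_split z)) spr.
  by rewrite !trmx_mul trmxK dg_tr -mulmxA spl.
apply: mx_setP2 => A B.
rewrite join_splitE [RHS]mxE [X in _ = X + _]mxE dg_mulE !mulmx_bd0.
under [in RHS]eq_bigr => v _ do rewrite mxE join_splitE.
under [X in _ = _ + _ * X]eq_bigr => v _ do rewrite join_splitE.
rewrite [X in _ + X]mulr_sumr.
have [/andP[sA sB] | nAB] := ifPn; last first.
  rewrite !big1 ?addr0 // => v vA; case: ifP; rewrite ?mulr0 //.
    case/andP=> sA' sB'; case/negP: nAB; rewrite sA'.
    by rewrite -(setU1K vA) simplex_setD1.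
  case/andP=> sA' sB'; case/negP: nAB; rewrite sB' andbT.
  by rewrite -(setU1K vA) simplex_setD1.
have [AS BS] : A \subset S1 /\ B \subset S2 by split; [case/andP: sA | case/andP: sB].
have disAB : [disjoint A & B] by apply: disjointWl AS (disjointWr BS dis).
rewrite mulr_sumr big_mkcond (big_mkcond (fun v => v \notin A)).
rewrite (big_mkcond (fun v => v \notin B)) -big_split /=.
apply: eq_bigr => v _; rewrite sA sB andbT andTb.
have nsl : v \notin S1 -> simplex e S1 (v |: A) = false.
  by move=> vS; rewrite /simplex subUset sub1set (negbTE vS).
have nsr : v \notin S2 -> simplex e S2 (v |: B) = false.
  by move=> vS; rewrite /simplex subUset sub1set (negbTE vS).
have nA : v \notin S1 -> v \notin A by apply: contra; apply: (subsetP AS).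
have nB : v \notin S2 -> v \notin B by apply: contra; apply: (subsetP BS).
rewrite in_setU chi_join //.
have [vS1 | vS1] := boolP (v \in S1).
  have vS2 := notin_S2 vS1.
  rewrite (nsr vS2) (negbTE (nB vS2)) orbF !mulr0 addr0.
  case: ifP => // vA; rewrite setUA.
  case: ifPn => [sAv | nsA]; last first.
    rewrite zE ?mulr0 // simplex_joinE ?(negbTE nsA) //.
    by rewrite subUset sub1set vS1.
  by rewrite cross_setU1l // !mulrA; congr (_ * _); rewrite -mulrA mulrC.
rewrite (nsl vS1) (negbTE (nA vS1)) /= mulr0 add0r.
have [vS2 | vS2] := boolP (v \in S2); last first.
  rewrite (nsr vS2) (nB vS2) !mulr0 zE ?mulr0 //.
  by rewrite /simplex !subUset sub1set inE (negbTE vS1) (negbTE vS2).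
case: ifP => // vB; rewrite setUCA.
case: ifPn => [sBv | nsB]; last first.
  rewrite zE ?mulr0 // simplex_joinE ?(negbTE nsB) ?andbF //.
  by rewrite subUset sub1set vS2.
rewrite cross_setU1r ?nA // !mulrA; congr (_ * _).
rewrite [X in _ = X * _ * _]mulrAC -expr2 sqrr_sign mul1r.
by rewrite -mulrA mulrC [X in X * _]mulrC.
Qed.

(** A primitive found by matrix algebra may have entries off the pairs of faces; this allows it to
    be truncated to a matrix that comes from a chain of the join. *)
Lemma joind_mask Y : simplices S1 *m joind Y *m simplices S2 =
  joind (simplices S1 *m Y *m simplices S2).
Proof.
have trI : (bdI S1)^T *m simplices S1 = (bdI S1)^T.
  by rewrite -[simplices S1]simplices_tr -trmx_mul simplices_ind_bd.
have Itr : simplices S1 *m (bdI S1)^T = (bdI S1)^T.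
  by rewrite -[simplices S1]simplices_tr -trmx_mul ind_bd_simplices.
have IE : simplices S1 *m sign_mx = sign_mx *m simplices S1.
  by rewrite !dg_mul; apply: eq_dg => F; rewrite mulrC.
rewrite /total_bd mulmxDr mulmxDl; congr (_ + _).
  by rewrite !mulmxA Itr trI.
move: (bdI S2) (ind_bd_simplices K e S2) (simplices_ind_bd K e S2) => D DI ID.
by rewrite !mulmxA IE -(mulmxA _ D) DI -(mulmxA _ (simplices S2) D) ID.
Qed.

(** * Nonvanishing homology of a join *)

Lemma bd0_simplices (z : 'rV[K]_N) R :
  z *m simplices R = z -> z *m bd0 = z *m bdI R.
Proof. by move=> zR; rewrite mulmxA zR. Qed.

Lemma exact_at_ind R p :
  ~~ homology_nz K e R p -> exact_at (bdI R) (simplices_at R p).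
Proof.
move=> nz0 Z ZF ZD; apply/row_subP => i.
have rF : row i Z *m simplices_at R p = row i Z by rewrite -row_mul ZF.
apply: contraNT nz0 => nb; apply/homology_nzP; exists (row i Z) => //; split=> //.
rewrite (@bd0_simplices _ R) -?row_mul ?ZD ?row0 //.
by rewrite -ZF -mulmxA simplices_at_simplices.
Qed.

(** By contraposition: if for every [p <= d] one factor has no homology in its degree, every cycle
    of the join bounds. Homogeneity of the matrix of [z] is the equation
    [#|A :|: B| = #|A| + #|B|]. *)
Lemma homology_nz_join_inv d : homology_nz K e S d ->
  exists2 p, (p <= d)%N & homology_nz K e S1 p && homology_nz K e S2 (d - p).
Proof.
case/homology_nzP=> z zF [zbd nb].
have [/existsP[p nz]|/existsPn no] := boolP [exists p : 'I_d.+1,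
  homology_nz K e S1 p && homology_nz K e S2 (d - p)].
  by exists p => //; rewrite -ltnS.
case/negP: nb.
have zS : z *m simplices S = z by rewrite -zF -mulmxA simplices_at_simplices.
have zcard F : #|F| != d -> z 0 (rk F) = 0.
  by rewrite -zF mul_dgE faceE => /negbTE ->; rewrite andbF mulr0.
have cardJ A B : A \subset S1 -> B \subset S2 -> #|A :|: B| = (#|A| + #|B|)%N.
  move=> sA sB; rewrite cardsU disjoint_setI0 ?cards0 ?subn0 //.
  exact: disjointWl sA (disjointWr sB dis).
have [Y splY] : exists Y, join_split z = joind Y.
  apply: (kunneth_exact (ind_complex K e S1) (ind_complex K e S2) (d := d)).
  - by rewrite -join_split_bd // zbd join_split0.
  - rewrite -mulmx_suml dg_sum; apply: mx_setP2 => A B; rewrite dg_mulE join_splitE.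
    case: ifP => [/andP[sA sB]|_]; last by rewrite mulr0.
    have [[AS _] [BS _]] := (andP sA, andP sB).
    have [cAB|/zcard->] := eqVneq #|A :|: B| d; last by rewrite !mulr0.
    have cA : (#|A| < d.+1)%N by rewrite -cAB cardJ // ltnS leq_addr.
    rewrite (bigD1 (Ordinal cA)) //= faceE sA eqxx big1 ?addr0 ?mul1r // => p.
    rewrite faceE sA /= => neq; case: eqP => // cp.
    by case/eqP: neq; apply: val_inj; rewrite /= cp.
  - move=> p le_pd; apply: mx_setP2 => A B; rewrite mul_dgE dg_mulE join_splitE.
    case: ifP => [/andP[sA sB]|_]; last by rewrite mulr0 mul0r.
    have [[AS _] [BS _]] := (andP sA, andP sB).
    have [cAB|/zcard->] := eqVneq #|A :|: B| d; last by rewrite !mulr0 mul0r.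
    rewrite !faceE sA sB /= -cAB cardJ //.
    by case: eqP => [<-|_]; rewrite ?mul0r // addKn eqxx mulr1.
  - move=> p le_pd; have := no (Ordinal (le_pd : (p < d.+1)%N)); rewrite /= negb_and.
    by case/orP => /exact_at_ind; [left | right].
pose Y' := simplices S1 *m Y *m simplices S2.
have splY' : join_split (join_merge Y') = Y'.
  by apply: join_mergeK; rewrite /Y' !mulmxA -!mulmxA !simplices_idem !mulmxA simplices_idem.
have yS := join_merge_simplices Y'.
have splz : join_split z = join_split (join_merge Y' *m bd0).
  rewrite join_split_bd // splY' -joind_mask -splY.
  rewrite -{1}(join_splitK zS); apply: mx_setP2 => A B.
  rewrite mul_dgE dg_mulE join_splitK // join_splitE.
  by case: simplex; case: simplex; rewrite ?(mulr0, mul0r, mul1r, mulr1).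
have -> : z = join_merge Y' *m bdI S.
  rewrite -(join_splitK zS) splz join_splitK ?(bd0_simplices yS) //.
  by rewrite -mulmxA ind_bd_simplices.
exact: submxMl.
Qed.

(** The product class is the rank one matrix [z1^T *m z2]. Cokernels detect it: [C1^T] on the left
    and [C2] on the right kill every total boundary, but send it to the outer product of the nonzero
    rows [z1 *m C1] and [z2 *m C2]. *)
Lemma homology_nz_join p q : homology_nz K e S1 p -> homology_nz K e S2 q ->
  homology_nz K e S (p + q).
Proof.
case/homology_nzP=> z1 z1F [z1bd nb1] /homology_nzP[z2 z2F [z2bd nb2]].
have z1S : z1 *m simplices S1 = z1 by rewrite -z1F -mulmxA simplices_at_simplices.
have z2S : z2 *m simplices S2 = z2 by rewrite -z2F -mulmxA simplices_at_simplices.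
pose M := z1^T *m z2.
have MK : join_split (join_merge M) = M.
  apply: join_mergeK; rewrite /M !mulmxA -[simplices S1]simplices_tr.
  by rewrite -trmx_mul z1S -mulmxA z2S.
have zS := join_merge_simplices M.
apply/homology_nzP; exists (join_merge M); last split.
- apply: mx_setP => i F; rewrite ord1 mul_dgE join_mergeE faceE.
  case: (boolP (simplex e S F)) => sF; last by rewrite mul0r.
  rewrite /M mxE big_ord1 mxE -z1F -z2F !mul_dgE !faceE /=.
  have FE : #|F| = (#|F :&: S1| + #|F :&: S2|)%N.
    have I0 : (F :&: S1) :&: (F :&: S2) = set0.
      apply: disjoint_setI0.
      by apply: disjointWl (subsetIr _ _) (disjointWr (subsetIr _ _) dis).
    rewrite -cardsUI I0 cards0 addn0 -setIUr; congr #|pred_of_set _|.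
    by apply/esym/setIidPl; case/andP: sF.
  rewrite FE; case: (#|F :&: S1| =P p) => [->|]; last by rewrite !(andbF, mulr0, mul0r).
  rewrite eqn_add2l; case: (#|F :&: S2| =P q) => _; by rewrite !(andbF, mulr0, mulr1).
- have bdS : join_merge M *m bd0 *m simplices S = join_merge M *m bd0.
    by rewrite (bd0_simplices zS) -mulmxA ind_bd_simplices.
  have z1D : z1 *m bdI S1 = 0 by rewrite -bd0_simplices.
  have z2D : z2 *m bdI S2 = 0 by rewrite -bd0_simplices.
  rewrite -(join_splitK bdS) join_split_bd // MK /total_bd /M.
  move: (bdI S1) (bdI S2) z1D z2D => D1 D2 z1D z2D.
  rewrite !mulmxA -trmx_mul z1D trmx0 mul0mx add0r -(mulmxA _ z2) z2D mulmx0.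
  by apply: mx_setP => i F; rewrite ord1 join_mergeE !mxE mulr0 if_same.
apply/negP=> /submxP[y yE].
have [Y MY] : exists Y, M = joind Y.
  exists (join_split (y *m simplices S)); rewrite -join_split_bd -?mulmxA ?simplices_idem //.
  by rewrite -MK yE.
move: nb1 nb2 (mulmx_coker (bdI S1)) (mulmx_coker (bdI S2)); rewrite !submxE.
move: (cokermx (bdI S1)) (cokermx (bdI S2)) => C1 C2 nb1 nb2 DC1 DC2.
have : C1^T *m M *m C2 = 0.
  rewrite MY /total_bd; move: (bdI S1) (bdI S2) DC1 DC2 => D1 D2 DC1 DC2.
  rewrite mulmxDr mulmxDl !mulmxA -trmx_mul DC1 trmx0 !mul0mx add0r.
  by rewrite -(mulmxA _ D2) DC2 mulmx0.
rewrite /M !mulmxA -trmx_mul -mulmxA => C0.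
have [/rV0Pn[i nzi] /rV0Pn[j nzj]] := (nb1, nb2).
have /matrixP/(_ i j)/eqP := C0.
rewrite mxE big_ord1 [X in X * _]mxE [X in _ == X]mxE mulf_eq0.
by rewrite (negbTE nzi) (negbTE nzj).
Qed.

End Join.

(** * Regularity *)

Section Regularity.
Variables (K : fieldType) (T : finType) (e : rel T).
Hypothesis e_sym : symmetric e.
Implicit Types (U W S : {set T}) (P Q : {set {set T}}).
Local Notation regK := (reg K e).
Local Notation prime_dec := (prime_decomposition K e).

Lemma homology_nz_le S d : homology_nz K e S d -> (d <= #|T|)%N.
Proof.
case/homology_nzP=> z zF [_]; apply: contraNleq => lt_Td.
suff -> : z = 0%R by rewrite sub0mx.
apply: mx_setP => i F; rewrite -zF mul_dgE faceE mxE.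
case: eqP => [cF|]; last by rewrite andbF GRing.mulr0.
by move: lt_Td; rewrite -cF ltnNge max_card.
Qed.

Lemma leq_reg U S d : S \subset U -> homology_nz K e S d -> (d <= regK U)%N.
Proof.
move=> sSU nz; apply: leq_trans (leq_bigmax_cond _ sSU).
have lt_d : (d < #|T|.+1)%N by rewrite ltnS (homology_nz_le nz).
exact: (leq_bigmax_cond (Ordinal lt_d) nz).
Qed.

(** Positivity excludes the default value 0 of an empty maximum, so the value is attained. *)
Lemma reg_witness U : (0 < regK U)%N ->
  exists2 S : {set T}, S \subset U & homology_nz K e S (regK U).
Proof.
rewrite /reg; elim/big_ind: _ => // [m n IHm IHn|S sSU].
  by rewrite /maxn; case: ifP.
move=> pos; exists S => //; move: pos.
elim/big_ind: _ => // m n IHm IHn.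
by rewrite /maxn; case: ifP.
Qed.

Lemma reg_mono U W : U \subset W -> (regK U <= regK W)%N.
Proof.
move=> sUW; case: (posnP (regK U)) => [-> //|/reg_witness[S sSU nz]].
exact: leq_reg (subset_trans sSU sUW) nz.
Qed.

Lemma reg0 : regK set0 = 0%N.
Proof.
case: (posnP (regK set0)) => // /[dup] pos /reg_witness[S].
rewrite subset0 => /eqP-> /homology_nzP[z zF [_ /negP[]]].
suff -> : z = 0%R by rewrite sub0mx.
apply: mx_setP => i F; rewrite -zF mul_dgE faceE /simplex subset0 mxE.
case: eqP => [->|]; last by rewrite GRing.mulr0.
by rewrite cards0 eq_sym (gtn_eqF pos) andbF GRing.mulr0.
Qed.

Section Join.
Variables (U W : {set T}).
Hypotheses (dis : [disjoint U & W]) (noedge : {in U & W, forall x y, ~~ e x y}).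

(** An induced subgraph of the union is the union of its traces on [U] and [W], so the Kunneth
    statement applies to every [S] in the maximum. When one regularity is 0, the lower bound follows
    from monotonicity instead of a witness. *)
Lemma reg_join : regK (U :|: W) = (regK U + regK W)%N.
Proof.
apply/eqP; rewrite eqn_leq; apply/andP; split.
  case: (posnP (regK (U :|: W))) => [-> //|/reg_witness[S sS nz]].
  have SE : S = (S :&: U) :|: (S :&: W).
    by rewrite -setIUr; apply/esym/setIidPl.
  move: nz; rewrite SE => /homology_nz_join_inv[||x y|p le_p /andP[nzp nzq]] //.
  - by apply: disjointWl (subsetIr _ _) (disjointWr (subsetIr _ _) dis).
  - by rewrite !inE => /andP[_ xU] /andP[_ yW]; apply: noedge.
  rewrite -(subnKC le_p) leq_add //.
    exact: leq_reg (subsetIr _ _) nzp.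
  exact: leq_reg (subsetIr _ _) nzq.
case: (posnP (regK U)) => [-> |/reg_witness[S1 sS1 nz1]].
  by rewrite add0n reg_mono ?subsetUr.
case: (posnP (regK W)) => [-> |/reg_witness[S2 sS2 nz2]].
  by rewrite addn0 reg_mono ?subsetUl.
apply: (leq_reg (setUSS sS1 sS2)); apply: homology_nz_join => //.
  by apply: disjointWl sS1 (disjointWr sS2 dis).
by move=> x y /(subsetP sS1) xU /(subsetP sS2); apply: noedge.
Qed.

End Join.

(** * Prime decompositions: additivity and existence *)

Lemma prime_decompositionP P :
  reflect [/\ {in P, forall U, prime_graph K e U}, trivIset P &
    {in P &, forall U W, U != W -> {in U & W, forall x y, ~~ e x y}}]
  (prime_dec P).
Proof.
apply: (iffP and3P) => [[/forall_inP pr tr /forall_inP sep] | [pr tr sep]].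
  split=> // U W UP WP neq x y xU yW.
  move/forall_inP/(_ W WP)/implyP/(_ neq): (sep U UP).
  by move/forall_inP/(_ x xU)/forall_inP; apply.
split=> //; first exact/forall_inP.
apply/forall_inP => U UP; apply/forall_inP => W WP; apply/implyP => neq.
by apply/forall_inP => x xU; apply/forall_inP => y yW; apply: (sep U W).
Qed.

Lemma reg_cover P : prime_dec P ->
  regK (cover P) = \sum_(U in P) regK U.
Proof.
have [n] := ubnP #|P|; elim: n P => // n IHn P; rewrite ltnS => le_Pn pdP.
have [-> | /set0Pn[U UP]] := eqVneq P set0.
  by rewrite /cover !big_set0 reg0.
have /prime_decompositionP[pr /trivIsetP tr sep] := pdP.
have ltU : (#|P :\ U| < n)%N by move: le_Pn; rewrite (cardsD1 U) UP.
rewrite /cover !(big_setD1 U UP) /= -IHn //.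
  apply: reg_join.
    apply: bigcup_disjoint => W /setD1P[neq WP]; rewrite eq_sym in neq.
    exact: tr.
  move=> x y xU /bigcupP[W /setD1P[neq WP]]; apply: sep xU => //.
  by rewrite eq_sym.
apply/prime_decompositionP; split=> [W /setD1P[_] /pr //||V W /setD1P[_ VP] /setD1P[_ WP]].
  by apply/trivIsetP => V W /setD1P[_ VP] /setD1P[_ WP]; apply: tr.
exact: sep.
Qed.

Lemma reg_le_prime_decomposition U : exists P,
  [/\ prime_dec P, cover P \subset U &
      (regK U <= \sum_(W in P) regK W)%N].
Proof.
have [n le_Un] := ubnP #|U|; elim: n U le_Un => // n IHn U; rewrite ltnS => le_Un.
have [-> | U0] := eqVneq U set0.
  exists set0; rewrite /cover !big_set0 sub0set reg0; split=> //.
  apply/prime_decompositionP; split=> [W||V W]; rewrite ?inE //.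
  by apply/trivIsetP => V W; rewrite inE.
have [/exists_inP[x xU le_x] | /exists_inPn drop] :=
    boolP [exists x in U, (regK U <= regK (U :\ x))%N].
  have ltx : (#|U :\ x| < n)%N by move: le_Un; rewrite (cardsD1 x) xU.
  have [P [pd cP rP]] := IHn _ ltx; exists P; split=> //.
    exact: subset_trans cP (subsetDl _ _).
  exact: leq_trans le_x rP.
(* Every vertex deletion now lowers the regularity, so a connected [U] is itself prime. *)
have [conn | ] := boolP (connected_in e U).
  exists [set U]; rewrite /cover !big_set1; split=> //.
  apply/prime_decompositionP; split=> [W /set1P->||V W /set1P-> /set1P->].
  - rewrite /prime_graph conn; apply/forall_inP => x xU.
    by rewrite ltnNge drop.
  - by apply/trivIsetP => V W /set1P-> /set1P->; rewrite eqxx.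
  - by rewrite eqxx.
rewrite negb_and U0 => /forall_inPn[x xU /forall_inPn[y yU nxy]].
pose r := [rel a b | [&& a \in U, b \in U & e a b]].
(* Only the component of [x] is split off. It misses [y] and its complement misses [x], so the
   induction applies to both sides. *)
pose U1 := [set z in U | connect r x z]; pose U2 := U :\: U1.
have sU1 : U1 \subset U by apply/subsetP=> z; rewrite inE => /andP[].
have UE : U = U1 :|: U2 by rewrite -{1}(setID U U1) (setIidPr sU1).
have dis : [disjoint U1 & U2].
  by rewrite disjoints_subset setCD subsetUr.
have noedge : {in U1 & U2, forall a b, ~~ e a b}.
  move=> a b; rewrite !inE => /andP[aU xa] /andP[nb bU].
  apply: contra nb => eab; rewrite bU (connect_trans xa) // connect1 //=.
  by rewrite aU bU.
have lt1 : (#|U1| < n)%N.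
  apply: leq_trans le_Un; apply: proper_card; apply/properP; split.
    exact: sU1.
  by exists y => //; rewrite inE yU.
have lt2 : (#|U2| < n)%N.
  apply: leq_trans le_Un; apply: proper_card; apply/properP; split.
    exact: subsetDl.
  by exists x => //; rewrite !inE xU connect0.
have [P1 [/prime_decompositionP[pr1 tr1 sep1] c1 r1]] := IHn _ lt1.
have [P2 [/prime_decompositionP[pr2 tr2 sep2] c2 r2]] := IHn _ lt2.
have sub1 W : W \in P1 -> W \subset U1.
  by move=> WP; apply: subset_trans c1; apply: bigcup_sup.
have sub2 W : W \in P2 -> W \subset U2.
  by move=> WP; apply: subset_trans c2; apply: bigcup_sup.
(* Prime graphs are nonempty, so no set belongs to both families and the sum over their union
   splits. *)
have disP : [disjoint P1 & P2].
  apply/pred0P => W /=; apply/negP => /andP[W1 W2].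
  have /andP[/andP[/set0Pn[z zW] _] _] := pr1 W W1.
  have := disjointFr dis (subsetP (sub1 _ W1) _ zW).
  by rewrite (subsetP (sub2 _ W2)).
exists (P1 :|: P2); split.
- apply/prime_decompositionP; split.
  + by move=> W; rewrite inE => /orP[/pr1 | /pr2].
  + apply/trivIsetP => V W; rewrite !inE => /orP[] VP /orP[] WP neq.
    * exact: (trivIsetP tr1).
    * exact: disjointWl (sub1 _ VP) (disjointWr (sub2 _ WP) dis).
    * rewrite disjoint_sym.
      exact: disjointWl (sub1 _ WP) (disjointWr (sub2 _ VP) dis).
    * exact: (trivIsetP tr2).
  + move=> V W; rewrite !inE => /orP[] VP /orP[] WP neq x' y' xV yW.
    * exact: (sep1 V W).
    * by apply: noedge; [apply: (subsetP (sub1 _ VP)) | apply: (subsetP (sub2 _ WP))].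
    * rewrite e_sym.
      by apply: noedge; [apply: (subsetP (sub1 _ WP)) | apply: (subsetP (sub2 _ VP))].
    * exact: (sep2 V W).
- by rewrite /cover bigcup_setU UE setUSS.
have -> : \sum_(W in P1 :|: P2) regK W = \sum_(W in P1) regK W + \sum_(W in P2) regK W.
  by rewrite -bigU //=; apply: eq_bigl => W; rewrite !inE.
by rewrite [X in regK X]UE reg_join // leq_add.
Qed.

End Regularity.

Theorem theorem1p1 (K : fieldType) (T : finType) (e : rel T)
  (e_sym : symmetric e) (e_irr : irreflexive e) :
  reg K e [set: T] =
  \max_(P : {set {set T}} | prime_decomposition K e P) \sum_(U in P) reg K e U.
Proof.
apply/eqP; rewrite eqn_leq; apply/andP; split; last first.
  (* The sum is the regularity of the subgraph induced on the cover, bounded by monotonicity. *)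
  by apply/bigmax_leqP => P /(reg_cover e_sym) <-; apply: reg_mono (subsetT _).
have [P [pdP _ /leq_trans]] := reg_le_prime_decomposition K e_sym [set: T].
by apply; apply: leq_bigmax_cond.
Qed.
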